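(* Put $G=SO(2)$ and $H=\{I_2\}$. Let $\rho\colon G\to GL(\mathbb{R}^2)$ be the natural representation. Then $v_0:=e_1\in\mathbb{R}^2$ is $H$-fixed, and the family $\mathcal{P}$ obtained from $(G,H,\mathbb{R}^2,v_0)$ by the method described in the context, under the identification $G/H\simeq S^1\simeq\mathbb{R}/2\pi\mathbb{Z}$ (rotation by the angle $x$ corresponds to $x$), is the family of von Mises distributions on $S^1$, $$\left\{\frac{1}{2\pi I_0(\kappa)}e^{-\kappa\cos(x-\mu)}dx\right\}_{(\kappa,\mu)\in\mathbb{R}_{>0}\times\mathbb{R}/2\pi\mathbb{Z}}.$$
   Context: $e_1$ is the first standard basis vector of $\mathbb{R}^2$. $dx$ is the uniform measure on $S^1$ with $\int_{S^1}dx=2\pi$. $I_m(r)=\frac{1}{2\pi}\int_0^{2\pi}\cos(mx)e^{r\cos x}dx$ ($m\in\mathbb{Z}$, $r\in\mathbb{R}$) is the modified Bessel function of the first kind of order $m$. The method: let $G$ be a Lie group with finitely many connected components, $H$ a closed subgroup, $X:=G/H$, $\rho\colon G\to GL(V)$ a continuous finite dimensional real representation and $v_0\in V$ an $H$-fixed vector. Put $W_0(G,H):=\{\tau\colon G\to\mathbb{R}\mid\tau\text{ is a continuous group homomorphism with }\tau|_H=0\}$. Take a nonzero relatively $G$-invariant Radon measure $\nu$ on $X$ (i.e. for some $\chi\colon G\to\mathbb{R}_{>0}$ the pushforward satisfies $g\cdot\nu=\chi(g)^{-1}\nu$ for all $g\in G$), assumed to exist; the resulting family does not depend on the choice of $\nu$.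 For $\theta=(\varphi,\tau)\in V^\vee\times W_0(G,H)$ (where $V^\vee$ is the dual space of $V$) and $x=gH$, put $\rho(x)v_0:=\rho(g)v_0$, $\tau(x):=\tau(g)$ and $d\tilde p_\theta(x):=\exp(-\langle\varphi,\rho(x)v_0\rangle+\tau(x))\,d\nu(x)$. Let $\Theta:=\{\theta\in V^\vee\times W_0(G,H)\mid\int_Xd\tilde p_\theta<\infty\}$ and, for $\theta\in\Theta$, $p_\theta:=(\int_Xd\tilde p_\theta)^{-1}\tilde p_\theta$. The family obtained is the set $\mathcal{P}:=\{p_\theta\}_{\theta\in\Theta}$ of probability measures on $X$.
   Formalization: The parameter θ=(0,0) lies in Θ and gives the uniform distribution, which is not von Mises with κ>0; the formal theorem therefore states that the family is the displayed von Mises family together with the uniform distribution (κ=0), and that the two are disjoint. *)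

(* Defs.v *)
From HB Require Import structures.
From mathcomp Require Import all_boot all_order all_algebra.
From mathcomp Require Import all_classical all_reals all_analysis.
From mathcomp Require Import measurable_realfun.

Set Implicit Arguments.
Unset Strict Implicit.
Unset Printing Implicit Defensive.

Import Order.TTheory GRing.Theory Num.Theory.
Import numFieldNormedType.Exports.

Local Open Scope classical_set_scope.
Local Open Scope ring_scope.
Local Open Scope quotient_scope.

HB.mixin Record isTopologicalGroup G of Group G & PointedTopological G := {
  mulg_continuous : continuous (fun xy : G * G => (xy.1 * xy.2)%g);
  invg_continuous : continuous (fun x : G => (x^-1)%g)
}.

#[short(type="topGroupType")]
HB.structure Definition TopologicalGroup :=
  {G of isTopologicalGroup G & Group G & PointedTopological G}.

Record closedSubgroup (G : topGroupType) := ClosedSubgroup {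
  subgroup_pred :> groupClosed G;
  subgroup_closed : closed [set x : G | x \in (subgroup_pred : {pred G})]
}.

Section CosetSpace.
Context (G : topGroupType) (H : closedSubgroup G).

Definition coset_rel : rel G := fun x y => (x^-1 * y)%g \in (H : {pred G}).

Lemma coset_refl : reflexive coset_rel.
Proof. by move=> x; rewrite /coset_rel mulVg gpred1. Qed.

Lemma coset_sym : symmetric coset_rel.
Proof. by move=> x y; rewrite /coset_rel -gpredV invgM invgK. Qed.

Lemma coset_trans : transitive coset_rel.
Proof.
move=> y x z; rewrite /coset_rel => xy yz.
have -> : (x^-1 * z = (x^-1 * y) * (y^-1 * z))%g by rewrite -mulgA mulVKg.
exact: gpredM.
Qed.

Definition coset_equiv := EquivRel coset_rel coset_refl coset_sym coset_trans.

Definition coset_space := quotient_topology {eq_quot coset_equiv}.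

HB.instance Definition _ := PointedTopological.on coset_space.
HB.instance Definition _ := Quotient.on coset_space.

Definition coset_of (g : G) : coset_space := \pi_(coset_space) g.

Definition coset_act (g : G) (x : coset_space) : coset_space :=
  coset_of (g * repr x)%g.

End CosetSpace.

Record continuousRep (R : realType) (G : topGroupType) (n : nat) :=
  ContinuousRep {
    rep_fun :> G -> 'M[R]_n;
    rep1 : rep_fun 1%g = 1%:M;
    repM : forall g h, rep_fun (g * h)%g = rep_fun g *m rep_fun h;
    rep_continuous : continuous rep_fun
  }.

Notation borel T := (g_sigma_algebraType (@open T)).

Section Measures.
Local Open Scope ereal_scope.
Context (R : realType).

Definition is_radon (T : ptopologicalType)
    (nu : {measure set (borel T) -> \bar R}) : Prop :=
  [/\ forall K : set T, compact K -> measurable (K : set (borel T)) ->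
        nu K < +oo,
      forall A : set (borel T), measurable A ->
        nu A = ereal_inf [set nu U | U in [set U : set T | open U /\ A `<=` U]]
    & forall U : set T, open U ->
        nu U = ereal_sup [set nu K | K in
          [set K : set T | [/\ compact K, measurable (K : set (borel T))
                             & K `<=` U]]] ].

(* [coset_act g @^-1` A] is g^-1 A, so the left-hand side is the value at A of
   the pushforward of nu by g. *)
Definition relatively_invariant (G : topGroupType) (H : closedSubgroup G)
    (nu : {measure set (borel (coset_space H)) -> \bar R}) : Prop :=
  exists chi : G -> R,
    (forall g, (0 < chi g)%R) /\
    forall g (A : set (borel (coset_space H))), measurable A ->
      nu (coset_act g @^-1` A) = ((chi g)^-1)%:E * nu A.

Definition admissible (G : topGroupType) (H : closedSubgroup G)
    (nu : {measure set (borel (coset_space H)) -> \bar R}) : Prop :=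
  [/\ is_radon nu, nu setT != 0 & relatively_invariant nu].

Definition transport (T U : ptopologicalType) (f : T -> U)
    (F : set (probability (borel T) R)) : set (probability (borel U) R) :=
  [set q | exists2 p, F p &
    forall A : set (borel U), measurable A -> q A = p (f @^-1` A)].

End Measures.

Section Method.
Local Open Scope ereal_scope.
Context (R : realType) (G : topGroupType) (H : closedSubgroup G) (n : nat).
Context (rho : continuousRep R G n) (v0 : 'cV[R]_n).

Local Notation X := (coset_space H).

Definition fixed_vector : Prop :=
  forall h, h \in (H : {pred G}) -> rho h *m v0 = v0.

Definition W0 : set (G -> R) := [set tau |
  [/\ continuous tau,
      forall g h, tau (g * h)%g = (tau g + tau h)%R
    & forall h, h \in (H : {pred G}) -> tau h = 0%R ]].

Definition param : Type := ({scalar 'cV[R]_n} * (G -> R))%type.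

(* [repr x] is a representative of the coset [x]; the values do not depend on
   it as soon as [v0] is fixed by H and [theta.2] belongs to [W0]. *)
Definition ptilde_density (theta : param) (x : X) : R :=
  expR (- theta.1 (rho (repr x) *m v0) + theta.2 (repr x)).

Context (nu : {measure set (borel X) -> \bar R}).

Definition ptilde (theta : param) (A : set (borel X)) : \bar R :=
  \int[nu]_(x in A) (ptilde_density theta x)%:E.

Definition Theta : set param :=
  [set theta | W0 theta.2 /\ ptilde theta setT < +oo].

Definition p_ (theta : param) (A : set (borel X)) : \bar R :=
  ((fine (ptilde theta setT))^-1)%:E * ptilde theta A.

(* The elements of a family are compared with p_theta on Borel sets only: the
   values of a [probability] outside the sigma-algebra are irrelevant. *)
Definition method_family : set (probability (borel X) R) :=
  [set p | exists2 theta, Theta theta &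
    forall A, measurable A -> p A = p_ theta A].

End Method.

Section TrivialSubgroup.
Context (G : topGroupType).

Definition triv_pred : {pred G} := pred1 1%g.

Lemma triv_mulg_closed : mulg_closed triv_pred.
Proof. by move=> x y /eqP -> /eqP ->; rewrite mulg1 inE. Qed.

Lemma triv_1 : 1%g \in triv_pred. Proof. by rewrite inE. Qed.

Lemma triv_invg_closed : invg_closed triv_pred.
Proof. by move=> x /eqP ->; rewrite invg1 inE. Qed.

HB.instance Definition _ := isMulClosed.Build G triv_pred triv_mulg_closed.
HB.instance Definition _ := isMul1Closed.Build G triv_pred triv_1.
HB.instance Definition _ := isInvClosed.Build G triv_pred triv_invg_closed.

Lemma triv_closed (hG : hausdorff_space G) :
  closed [set x : G | x \in (triv_pred : {pred G})].
Proof.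
rewrite (_ : [set x | _] = [set 1%g]).
  by apply: accessible_closed_set1; exact: hausdorff_accessible.
by apply/seteqP; split => x /=; rewrite inE => /eqP.
Qed.

Definition trivial_subgroup (hG : hausdorff_space G) : closedSubgroup G :=
  ClosedSubgroup (triv_closed hG).

End TrivialSubgroup.

Section SpecialOrthogonal.
Context (R : realType) (n : nat).

Definition SO_pred : pred 'M[R]_n :=
  fun A => (A *m A^T == 1%:M) && (\det A == 1).

Record SO := MkSO { SO_val :> 'M[R]_n; SO_valP : SO_pred SO_val }.

HB.instance Definition _ := [isSub for SO_val].
HB.instance Definition _ := [Choice of SO by <:].

Lemma SO_mulmx_tr (A : SO) : SO_val A *m (SO_val A)^T = 1%:M.
Proof. by case/andP: (SO_valP A) => /eqP. Qed.

Lemma SO_tr_mulmx (A : SO) : (SO_val A)^T *m SO_val A = 1%:M.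
Proof. exact/mulmx1C/SO_mulmx_tr. Qed.

Lemma SO_det (A : SO) : \det (SO_val A) = 1.
Proof. by case/andP: (SO_valP A) => _ /eqP. Qed.

Lemma SO_one_subproof : SO_pred 1%:M.
Proof. by rewrite /SO_pred trmx1 mulmx1 det1 !eqxx. Qed.

Lemma SO_mul_subproof (A B : SO) : SO_pred (SO_val A *m SO_val B).
Proof.
rewrite /SO_pred trmx_mul mulmxA -(mulmxA (SO_val A)) SO_mulmx_tr mulmx1.
by rewrite SO_mulmx_tr det_mulmx !SO_det mulr1 !eqxx.
Qed.

Lemma SO_inv_subproof (A : SO) : SO_pred ((SO_val A)^T).
Proof. by rewrite /SO_pred trmxK SO_tr_mulmx det_tr SO_det !eqxx. Qed.

Definition SO_one : SO := MkSO SO_one_subproof.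
Definition SO_mul (A B : SO) : SO := MkSO (SO_mul_subproof A B).
Definition SO_inv (A : SO) : SO := MkSO (SO_inv_subproof A).

Lemma SO_mulA : associative SO_mul.
Proof. by move=> A B C; apply: val_inj; rewrite /= mulmxA. Qed.
Lemma SO_mul1 : left_id SO_one SO_mul.
Proof. by move=> A; apply: val_inj; rewrite /= mul1mx. Qed.
Lemma SO_1mul : right_id SO_one SO_mul.
Proof. by move=> A; apply: val_inj; rewrite /= mulmx1. Qed.
Lemma SO_mulV : left_inverse SO_one SO_inv SO_mul.
Proof. by move=> A; apply: val_inj; rewrite /= SO_tr_mulmx. Qed.
Lemma SO_Vmul : right_inverse SO_one SO_inv SO_mul.
Proof. by move=> A; apply: val_inj; rewrite /= SO_mulmx_tr. Qed.

HB.instance Definition _ :=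
  isGroup.Build SO SO_mulA SO_mul1 SO_1mul SO_mulV SO_Vmul.
HB.instance Definition _ := isPointed.Build SO SO_one.
HB.instance Definition _ := Topological.copy SO (initial_topology SO_val).

Lemma SO_val_continuous : continuous SO_val.
Proof. exact: (@initial_continuous SO 'M[R]_n SO_val). Qed.

Lemma mx_entry_continuous (T : topologicalType) (f : T -> 'M[R]_n) :
  (forall i j, continuous (fun x => f x i j)) -> continuous f.
Proof.
move=> cf x U [P Pnbhs PU]; rewrite /nbhs /=.
have : \forall y \near x, forall ij : 'I_n * 'I_n, P ij.1 ij.2 (f y ij.1 ij.2).
  apply: filter_forall => -[i j] /=; exact: (cf i j x _ (Pnbhs i j)).
by apply: filterS => y Py; apply: PU => i j; exact: (Py (i, j)).
Qed.

Lemma SO_valued_continuous (T : topologicalType) (f : T -> SO) :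
  (forall i j, continuous (fun x => SO_val (f x) i j)) -> continuous f.
Proof.
move=> cf; apply: continuous_comp_initial.
exact: mx_entry_continuous.
Qed.

Lemma SO_entry_continuous i j : continuous (fun A : SO => SO_val A i j).
Proof.
move=> A; apply: (@continuous_comp _ _ _ SO_val (fun M : 'M[R]_n => M i j)).
  exact: SO_val_continuous.
exact: coord_continuous.
Qed.

Lemma SO_mul_continuous :
  continuous (fun AB : SO * SO => (AB.1 * AB.2)%g).
Proof.
apply: SO_valued_continuous => i j AB.
rewrite (_ : (fun _ => _) = fun X : SO * SO =>
  \sum_k SO_val (X.1) i k * SO_val (X.2) k j); last first.
  by apply/funext => X; rewrite /= mxE.
apply: cvg_big => [|k _]; first exact: add_continuous.
apply: cvgM.
  by apply: (@continuous_comp _ _ _ fst (fun A : SO => SO_val A i k));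
    [exact: cvg_fst | exact: SO_entry_continuous].
by apply: (@continuous_comp _ _ _ snd (fun A : SO => SO_val A k j));
  [exact: cvg_snd | exact: SO_entry_continuous].
Qed.

Lemma SO_inv_continuous : continuous (fun A : SO => (A^-1)%g).
Proof.
apply: SO_valued_continuous => i j.
rewrite (_ : (fun _ => _) = fun A : SO => SO_val A j i).
  exact: SO_entry_continuous.
by apply/funext => A; rewrite /= mxE.
Qed.

HB.instance Definition _ :=
  isTopologicalGroup.Build SO SO_mul_continuous SO_inv_continuous.

Lemma SO_hausdorff : hausdorff_space SO.
Proof.
move=> A B AB; apply: val_inj; apply/matrixP => i j.
apply: (@Rhausdorff R) => U V UA VB.
have [C [/= CU CV]] := AB _ _ (SO_entry_continuous UA) (SO_entry_continuous VB).
by exists (SO_val C i j).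
Qed.

Definition natural_rep : continuousRep R SO n :=
  @ContinuousRep R SO n SO_val erefl (fun _ _ => erefl) SO_val_continuous.

End SpecialOrthogonal.

Section Circle.
Context (R : realType).

Definition circle_rel : rel R := fun x y => `[< exists k : int,
  x - y = 2 * pi * k%:~R >].

Lemma circle_refl : reflexive circle_rel.
Proof. by move=> x; apply/asboolP; exists 0; rewrite subrr mulr0. Qed.

Lemma circle_sym : symmetric circle_rel.
Proof.
have H x y : circle_rel x y -> circle_rel y x.
  move=> /asboolP[k xyk]; apply/asboolP; exists (- k).
  by rewrite mulrNz mulrN -xyk opprB.
by move=> x y; apply/idP/idP; exact: H.
Qed.

Lemma circle_trans : transitive circle_rel.
Proof.
move=> y x z /asboolP[k xyk] /asboolP[l yzl]; apply/asboolP; exists (k + l).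
by rewrite intrD mulrDr -xyk -yzl addrA subrK.
Qed.

Definition circle_equiv := EquivRel circle_rel circle_refl circle_sym circle_trans.

Definition circle := quotient_topology {eq_quot circle_equiv}.

HB.instance Definition _ := PointedTopological.on circle.
HB.instance Definition _ := Quotient.on circle.

Definition to_circle (x : R) : circle := \pi_circle x.

Lemma to_circle_measurable :
  measurable_fun [set: R] (to_circle : R -> borel circle).
Proof.
apply: (@measurability _ _ _ (borel circle) _ _ (@open circle)) => //.
move=> _ [U oU <-]; rewrite setTI; apply: open_measurable.
exact: oU.
Qed.

(* The uniform measure dx of total mass 2pi: the image in R/2piZ of the
   Lebesgue measure on [0, 2pi[. *)
Definition circle_dx : set (borel circle) -> \bar R :=
  pushforward (mrestr (@lebesgue_measure R)
    (measurable_itv `[(0 : R), 2 * pi[)) (to_circle : R -> borel circle).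

Let circle_dx0 : circle_dx set0 = 0%E.
Proof. by rewrite /circle_dx /pushforward preimage_set0 measure0. Qed.

Let circle_dx_ge0 A : (0 <= circle_dx A)%E.
Proof. by rewrite /circle_dx /pushforward measure_ge0. Qed.

Let circle_dx_sigma_additive : semi_sigma_additive circle_dx.
Proof.
move=> F mF tF mUF; rewrite /circle_dx /pushforward preimage_bigcup.
apply: measure_semi_sigma_additive.
- by move=> k; rewrite -[X in measurable X]setTI; exact: to_circle_measurable.
- apply/trivIsetP => /= i j _ _ ij; rewrite -preimage_setI.
  by move/trivIsetP : tF => /(_ _ _ _ _ ij) ->//; rewrite preimage_set0.
- rewrite -preimage_bigcup -[X in measurable X]setTI.
  exact: to_circle_measurable.
Qed.

HB.instance Definition _ := isMeasure.Build _ _ _ circle_dx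
  circle_dx0 circle_dx_ge0 circle_dx_sigma_additive.

(* By periodicity, cos (x - mu) does not depend on the representatives. *)
Definition circle_cos_sub (x mu : circle) : R := cos (repr x - repr mu).

Definition besselI (m : int) (r : R) : R :=
  (2 * pi)^-1 * \int[lebesgue_measure]_(x in `[0, 2 * pi])
                  (cos (m%:~R * x) * expR (r * cos x)).

Definition von_mises_density (kappa : R) (mu x : circle) : R :=
  (2 * pi * besselI 0 kappa)^-1 * expR (- kappa * circle_cos_sub x mu).

Definition von_mises_family : set (probability (borel circle) R) :=
  [set q | exists (kappa : R) (mu : circle), 0 < kappa /\
    forall A : set (borel circle), measurable A ->
      q A = (\int[circle_dx]_(x in A) (von_mises_density kappa mu x)%:E)%E].

(* The probability measure of constant density; it is unique on Borel sets. *)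
Definition uniform_family : set (probability (borel circle) R) :=
  [set q | forall A : set (borel circle), measurable A ->
    q A = (((2 * pi)^-1)%:E * circle_dx A)%E].

End Circle.

Arguments von_mises_family R : clear implicits.
Arguments uniform_family R : clear implicits.

Section Identification.
Context (R : realType).

Definition rotation_mx (x : R) : 'M[R]_2 :=
  \matrix_(i, j) if i == j then cos x else if i == 0 then - sin x else sin x.

Lemma rotation_mx_SO x : SO_pred (rotation_mx x).
Proof.
have cs : cos x * cos x + sin x * sin x = 1 by rewrite -!expr2 cos2Dsin2.
apply/andP; split; apply/eqP.
  apply/matrixP => i j; rewrite !mxE !big_ord_recl big_ord0 !mxE addr0.
  case: i j => [[|[|//]] ?] [[|[|//]] ?] /=; rewrite ?mulNr ?mulrN ?opprK //.
  - by rewrite mulrC subrr.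
  - by rewrite mulrC addrN.
  - by rewrite addrC.
rewrite (expand_det_row _ 0) !big_ord_recl big_ord0 /cofactor !det_mx11 !mxE /=.
by rewrite addr0 /bump /= expr0 expr1 mul1r mulN1r mulNr mulrN opprK.
Qed.

Definition rotation (x : R) : SO R 2 := MkSO (rotation_mx_SO x).

Definition SO2_trivial : closedSubgroup (SO R 2) :=
  trivial_subgroup (@SO_hausdorff R 2).

Definition e1 : 'cV[R]_2 := delta_mx 0 0.

Definition angle_coset (x : circle R) : coset_space SO2_trivial :=
  coset_of SO2_trivial (rotation (repr x)).

End Identification.

Arguments angle_coset {R} x.

Definition inverse_homeomorphisms (T U : topologicalType)
    (f : T -> U) (g : U -> T) : Prop :=
  [/\ cancel f g, cancel g f, continuous f & continuous g].

(* Main.v *)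
Require Import Defs.
From HB Require Import structures.
From mathcomp Require Import all_boot all_order all_algebra.
From mathcomp Require Import all_classical all_reals all_analysis.
From mathcomp Require Import measurable_realfun ring lra.

(* Rotation by t gives a continuous surjection from R onto G/H, injective on
   [0, 2pi[ and with measurable inverse there. Every admissible measure is
   finite, because G/H is compact, hence invariant, and Fubini's theorem on
   [0, 2pi[ x G/H shows that it is a multiple of the image of the Lebesgue
   measure on [0, 2pi[. A continuous homomorphism from the compact group SO(2)
   to R vanishes, so only the linear form contributes to the density; its value
   at rotation t e1 is a cos t + b sin t = kappa cos (t - mu) in polar
   coordinates, with kappa = 0 exactly for the zero form. The normalizing
   constant is 2 pi I_0(kappa) by invariance under the rotation by pi - mu. *)

Set Implicit Arguments.
Unset Strict Implicit.
Unset Printing Implicit Defensive.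

Import Order.TTheory GRing.Theory Num.Theory.
Import numFieldNormedType.Exports.

Local Open Scope classical_set_scope.
Local Open Scope ring_scope.

(** * Periodicity of the trigonometric functions and translation invariance of Lebesgue measure *)

Section Periodic.
Context (R : realType).

Lemma cos_add_period (x : R) (k : int) : cos (x + 2 * pi * k%:~R) = cos x.
Proof.
have cosn y n : cos (y + 2 * pi * n%:R) = cos y :> R.
  by rewrite (mulr_natl pi 2) mulr_natr (periodicn (@cosD2pi R)).
case: k => n; first exact: cosn.
(* [Negz n] stands for -(n+1), so the natural case is used with n+1 periods. *)
by rewrite NegzE mulrNz mulrN -(cosn (x - _) n.+1) subrK.
Qed.

Lemma sin_add_period (x : R) (k : int) : sin (x + 2 * pi * k%:~R) = sin x.
Proof. by rewrite -!cosBpihalf addrAC cos_add_period. Qed.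

(** Reduction modulo 2pi gives y in [0, 2pi[. Injectivity of cosine on [0, pi] is applied to y, or,
    if y > pi, to 2pi - y, where it yields the contradiction y = 2pi. *)
Lemma cos_eq1 (x : R) : cos x = 1 -> exists k : int, x = 2 * pi * k%:~R.
Proof.
move=> cx; have pi0 := @pi_gt0 R.
have tau0 : 0 < 2 * pi :> R by rewrite mulr_gt0.
pose k := Num.floor (x / (2 * pi)); exists k.
pose y := x - 2 * pi * k%:~R.
have cy : cos y = 1.
  by rewrite /y -mulrN -mulrNz cos_add_period.
have y0 : 0 <= y.
  by rewrite subr_ge0 mulrC -ler_pdivlMr// Num.Theory.floor_le.
have y2 : y < 2 * pi.
  rewrite ltrBlDr.
  have := Num.Theory.floorD1_gt (x / (2 * pi)).
  by rewrite -/k ltr_pdivrMr// intrD mulrDl mul1r addrC (mulrC k%:~R).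
have [ypi|piy] := leP y pi.
  apply/eqP; rewrite -subr_eq0 -/y; apply/eqP/(@cos_inj R).
  - by rewrite in_itv/= y0.
  - by rewrite in_itv/= lexx pi_ge0.
  - by rewrite cy cos0.
have : 2 * pi - y = 0.
  apply: (@cos_inj R).
  - by rewrite in_itv/=; apply/andP; split; lra.
  - by rewrite in_itv/= lexx pi_ge0.
  - by rewrite -(cosN (_ - _)) opprB cos0 -[X in _ - X]mulr1 -[1]/(1%:~R) -mulrN
      -mulrNz cos_add_period.
by move/eqP; rewrite subr_eq0 => /eqP e; move: y2; rewrite e ltxx.
Qed.

Local Notation mu := (@lebesgue_measure R).

Lemma measurable_addr (a : R) :
  measurable_fun [set: measurableTypeR R] (fun t => t + a : measurableTypeR R).
Proof. exact: measurable_funD. Qed.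

(** Lebesgue measure is determined by its values on the intervals ]x, y], where the claim is a
    computation of lengths. *)
Lemma lebesgue_measure_addr (a : R) (A : set (measurableTypeR R)) :
  measurable A -> mu ((fun t => t + a) @^-1` A) = mu A.
Proof.
move=> mA; apply/esym.
apply: (@lebesgue_measure_unique R
  (pushforward mu (fun t : R => t + a : measurableTypeR R))) => //=.
  exact: measurable_addr.
move=> _ _ [[x y]] _ <-.
rewrite /pushforward (_ : _ @^-1` _ = `]x - a, y - a]%classic).
  by rewrite !lebesgue_measure_itv/= !lte_fin ltrD2r -!EFinB opprB addrA subrK.
by apply/seteqP; split => t /=; rewrite !in_itv/= ltrBlDr lerBrDr.
Qed.

End Periodic.

(** * One period of the line, rotations of the plane and their angles *)

Section Angle.
Context (R : realType).

Local Notation mu := (@lebesgue_measure R).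
Local Notation period := (2 * pi : R).

(** Kept as a measure on the whole line because [to_circle] and [coset_rot] are defined there;
    [circle_dx] is its image by conversion. *)
Definition arc_measure : set (measurableTypeR R) -> \bar R :=
  mrestr mu (measurable_itv `[(0 : R), period[).

HB.instance Definition _ := Measure.on arc_measure.

Lemma arc_measure_setT : arc_measure setT = period%:E.
Proof.
rewrite /arc_measure /mrestr setTI lebesgue_measure_itv/= lte_fin.
by rewrite mulr_gt0 ?pi_gt0// sube0.
Qed.

Let arc_measure_fin : fin_num_fun arc_measure.
Proof.
move=> A mA; rewrite ge0_fin_numE// (@le_lt_trans _ _ (arc_measure setT))//.
  by apply: le_measure; rewrite ?inE.
by rewrite [arc_measure _]arc_measure_setT ltry.
Qed.

HB.instance Definition _ := Measure_isFinite.Build _ _ _ arc_measure arc_measure_fin.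

(** The window [0, 2pi[ becomes [a, 2pi + a[, and periodicity of [E] brings the part beyond 2pi back
    to [0, a[. *)
Lemma arc_measure_shift (a : R) (E : set (measurableTypeR R)) :
  0 <= a < period -> measurable E ->
  (forall t, E (t + period) <-> E t) ->
  arc_measure ((fun t => a + t) @^-1` E) = arc_measure E.
Proof.
move=> /andP[a0 at_] mE perE; rewrite /arc_measure /mrestr.
have mI (i : interval R) : measurable (E `&` [set` i] : set (measurableTypeR R)).
  by apply: measurableI => //; exact: measurable_itv.
have -> : (fun t => a + t) @^-1` E `&` `[0, period[ =
    (fun t => t + a) @^-1` (E `&` `[a, period + a[).
  apply/seteqP; split => t /=; rewrite !in_itv/= ltrD2r;
    by rewrite (addrC t) lerDl.
rewrite lebesgue_measure_addr//.
have -> : E `&` `[a, period + a[ =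
    (E `&` `[a, period[) `|` (fun t => t + - period) @^-1` (E `&` `[0, a[).
  apply/seteqP; split => t /=; rewrite !in_itv/= subr_ge0 ltrBlDr (addrC a).
    move=> [Et /andP[at' ta]]; case: (ltP t period) => tp.
      by left; split=> //; rewrite at'.
    by right; split; [rewrite -perE subrK | rewrite ta].
  move=> [[Et /andP[at' tp]]|[Et /andP[tp ta]]].
    by rewrite at' (lt_le_trans tp)// lerDl.
  move: Et; rewrite -perE subrK => Et; split => //.
  by rewrite ta (le_trans (ltW at_)).
have -> : E `&` `[0, period[ = (E `&` `[a, period[) `|` (E `&` `[0, a[).
  rewrite -setIUr; congr (_ `&` _); apply/seteqP; split => t /=; rewrite !in_itv/=.
    by move=> /andP[t0 tp]; case: (ltP t a) => ta; [right|left]; apply/andP.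
  move=> [/andP[h1 ->]|/andP[-> h1]]; rewrite ?andbT/=.
    exact: le_trans h1.
  exact: lt_trans at_.
have mS (i : interval R) :
    measurable ((fun t => t + - period) @^-1` (E `&` [set` i]) : set (measurableTypeR R)).
  by rewrite -[X in measurable X]setTI; exact: (measurable_addr _ _ (mI i)).
rewrite !measureU//=.
- by rewrite lebesgue_measure_addr.
- apply/seteqP; split => t //=; rewrite !in_itv/=.
  by move=> [[_ /andP[h _]] [_ /andP[_ h']]]; move: h'; rewrite ltNge h.
- apply/seteqP; split => t //=; rewrite !in_itv/= subr_ge0.
  by move=> [[_ /andP[_ h]] [_ /andP[h' _]]]; move: h; rewrite ltNge h'.
Qed.

Lemma rotationD (x y : R) : rotation (x + y) = (rotation x * rotation y)%g.
Proof.
apply: val_inj; apply/matrixP => i j; rewrite !mxE !big_ord_recl big_ord0 !mxE addr0.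
case: i j => [[|[|//]] ?] [[|[|//]] ?] /=; rewrite ?cosD ?sinD; ring.
Qed.

Lemma rotation_eqP (x y : R) :
  rotation x = rotation y <-> to_circle x = to_circle y.
Proof.
split=> [xy|].
  have c : cos x = cos y.
    by have := congr1 (fun A : SO R 2 => SO_val A 0 0) xy; rewrite !mxE.
  have s : sin x = sin y.
    by have := congr1 (fun A : SO R 2 => SO_val A 1 0) xy; rewrite !mxE.
  apply/eqmodP/asboolP; apply: cos_eq1.
  by rewrite cosB c s -!expr2 cos2Dsin2.
move/eqmodP/asboolP => -[k xyk].
apply: val_inj; apply/matrixP => i j; rewrite !mxE.
by rewrite -(subrK y x) xyk addrC cos_add_period sin_add_period.
Qed.

Lemma rotation_continuous : continuous (@rotation R).
Proof.
apply: SO_valued_continuous => i j.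
rewrite (_ : (fun _ => _) = fun x : R =>
    if i == j then cos x else if i == 0 then - sin x else sin x); last first.
  by apply/funext => x; rewrite mxE.
case: (i == j); first exact: continuous_cos.
case: (i == 0); last exact: continuous_sin.
by move=> x; apply: cvgN; exact: continuous_sin.
Qed.

(** The argument of the unit vector (c, s): [acos] only reaches the upper half circle, and a
    negative [s] selects the reflected angle. *)
Definition unit_arg (c s : R) : R := if 0 <= s then acos c else period - acos c.

Lemma unit_argP (c s : R) : c ^+ 2 + s ^+ 2 = 1 ->
  [/\ 0 <= unit_arg c s < period, cos (unit_arg c s) = c & sin (unit_arg c s) = s].
Proof.
move=> cs1; have pi0 := @pi_gt0 R.
have c11 : -1 <= c <= 1.
  by rewrite -ler_norml -(@expr_le1 _ 2)// real_normK ?num_real// -cs1 lerDl sqr_ge0.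
have sq : 1 - c ^+ 2 = s ^+ 2 by rewrite -cs1 addrAC subrr add0r.
have h0 := acos_ge0 c11; have h1 := acos_lepi c11.
rewrite /unit_arg; case: ifPn => [s0|]; [split|rewrite -ltNge => s0; split].
- by apply/andP; split => //; lra.
- by rewrite acosK// in_itv.
- by rewrite sin_acos// sq sqrtr_sqr ger0_norm.
(* This makes the bound by 2pi strict: c = 1 would force s = 0. *)
- have : 0 < acos c.
    apply: acos_gt0; case/andP: c11 => -> c1 /=; rewrite lt_neqAle c1 andbT.
    apply: contraTneq s0 => e; move: sq; rewrite e expr1n subrr => /eqP.
    by rewrite eq_sym sqrf_eq0 => /eqP ->; rewrite ltxx.
  by move=> ?; apply/andP; split; lra.
- by rewrite -[LHS]cosN opprB -(cos_add_period _ 1) mulr1 subrK acosK// in_itv.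
- rewrite -(sin_add_period _ (-1)) mulrNz mulr1z mulrN1 addrAC subrr add0r.
  by rewrite sinN sin_acos// sq sqrtr_sqr ltr0_norm ?opprK.
Qed.

Lemma polar_coordinates (a b : R) :
  exists2 k : R, 0 <= k & exists m : R, a = k * cos m /\ b = k * sin m.
Proof.
pose k := Num.sqrt (a ^+ 2 + b ^+ 2); exists k; first exact: sqrtr_ge0.
have k2 : k ^+ 2 = a ^+ 2 + b ^+ 2 by rewrite sqr_sqrtr// addr_ge0 ?sqr_ge0.
(* The origin has no direction to normalize; the angle 0 serves. *)
have [k0|k0] := eqVneq k 0.
  exists 0; move: k2; rewrite k0 expr0n/= !mul0r => /esym/eqP.
  by rewrite paddr_eq0 ?sqr_ge0// !sqrf_eq0 => /andP[/eqP-> /eqP->].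
exists (unit_arg (a / k) (b / k)).
have [|_ -> ->] := @unit_argP (a / k) (b / k); last by rewrite ![k * _]mulrC !divfK.
by rewrite !expr_div_n -mulrDl -k2 divff// expf_neq0.
Qed.

Lemma SO2_entries (A : SO R 2) :
  [/\ SO_val A 1 1 = SO_val A 0 0, SO_val A 0 1 = - SO_val A 1 0 &
    SO_val A 0 0 ^+ 2 + SO_val A 1 0 ^+ 2 = 1].
Proof.
have e i j := congr1 (fun M : 'M[R]_2 => M i j) (SO_mulmx_tr A).
have := SO_det A; rewrite (expand_det_row _ 0) !big_ord_recl big_ord0.
rewrite /cofactor !det_mx11 !mxE /= addr0 /bump /= expr0 expr1 mul1r mulN1r.
have := e 0 0; have := e 0 1; have := e 1 1.
rewrite !mxE !big_ord_recl !big_ord0 !mxE /=.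
have -> : lift 0 0 = 1 :> 'I_2 by apply: val_inj.
have -> : lift 1 0 = 0 :> 'I_2 by apply: val_inj.
rewrite !addr0.
set a := SO_val A 0 0; set b := SO_val A 0 1; set c := SO_val A 1 0.
set d := SO_val A 1 1; rewrite /= ?expr0 ?expr1.
move=> h1 h2 h3 h4.
(* [d - a], and likewise [b + c] below, is an explicit combination of the orthonormality relations
   of the rows and of the determinant relation. *)
have da : d - a = 0.
  have -> : d - a = d * (1 - (a * a + b * b)) + a * (a * d + b * - c - 1)
    + b * (a * c + b * d) by ring.
  by rewrite h2 h3 h4 !subrr !mulr0 !addr0.
have bc : b + c = 0.
  have -> : b + c = b * (1 - (c * c + d * d)) - c * (a * d + b * - c - 1)
    + d * (a * c + b * d) by ring.
  by rewrite h2 h1 h4 !subrr !mulr0 subr0 addr0.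
have b_c : b = - c by apply/eqP; rewrite -addr_eq0 bc.
split => //; first by apply/eqP; rewrite -subr_eq0 da.
by move: h3; rewrite b_c mulrNN !expr2.
Qed.

Definition SO2_angle (A : SO R 2) : R := unit_arg (SO_val A 0 0) (SO_val A 1 0).

Lemma SO2_angleP (A : SO R 2) :
  0 <= SO2_angle A < period /\ rotation (SO2_angle A) = A.
Proof.
have [A11 A01 A1] := SO2_entries A.
have [rg ca sa] := unit_argP A1; split => //.
apply: val_inj; apply/matrixP => i j; rewrite !mxE ca sa.
have E (k : 'I_2) : k = 0 \/ k = 1.
  by case: k => [[|[|//]] ?]; [left|right]; apply: val_inj.
by case: (E i) (E j) => -> [] -> /=; rewrite ?A01 ?A11.
Qed.

End Angle.

(** * Topology and Borel structure of the coset space, parametrized by an angle *)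

Section CosetArc.
Context (R : realType).

Local Notation period := (2 * pi : R).
Local Notation X := (coset_space (SO2_trivial R)).
Local Notation mR := (measurableTypeR R).

(** The subgroup is trivial, so a coset contains a single element. *)
Lemma repr_coset_of (g : SO R 2) : repr (coset_of (SO2_trivial R) g) = g.
Proof.
have : coset_of (SO2_trivial R) (repr (coset_of (SO2_trivial R) g)) =
  coset_of (SO2_trivial R) g by exact: reprK.
move/eqmodP; rewrite /= /coset_rel /= inE => /eqP e.
by rewrite -[LHS]mulg1 -e mulgA mulgV mul1g.
Qed.

Definition coset_rot (t : R) : X := coset_of (SO2_trivial R) (rotation t).

Definition coset_arg (x : X) : R := SO2_angle (repr x).

Lemma coset_arg_ge0 x : 0 <= coset_arg x.
Proof. by have [/andP[]] := SO2_angleP (repr x). Qed.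

Lemma coset_arg_lt x : coset_arg x < period.
Proof. by have [/andP[]] := SO2_angleP (repr x). Qed.

Lemma coset_argK : cancel coset_arg coset_rot.
Proof.
move=> x; rewrite /coset_rot /coset_arg.
by have [_ ->] := SO2_angleP (repr x); exact: reprK.
Qed.

Lemma coset_rot_eqP t u : coset_rot t = coset_rot u <-> to_circle t = to_circle u.
Proof.
rewrite -rotation_eqP; split=> [e|]; last by rewrite /coset_rot => ->.
by rewrite -(repr_coset_of (rotation t)) -/(coset_rot t) e repr_coset_of.
Qed.

Lemma to_circle_arg t : to_circle (coset_arg (coset_rot t)) = to_circle t.
Proof. by apply/coset_rot_eqP; rewrite coset_argK. Qed.

(** Two angles in [0, 2pi[ that differ by 2pi k satisfy -1 < k < 1. *)
Lemma coset_rotK t : 0 <= t < period -> coset_arg (coset_rot t) = t.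
Proof.
move=> /andP[t0 tp]; have := to_circle_arg t.
have := coset_arg_ge0 (coset_rot t); have := coset_arg_lt (coset_rot t).
set u := coset_arg _ => up u0 /eqmodP/asboolP[k utk].
have pi0 := @pi_gt0 R.
have k1 : (k < 1)%R.
  rewrite -(ltr_int R) -(ltr_pM2l (_ : 0 < period)) ?mulr_gt0// -utk mulr1; lra.
have k0 : (-1 < k)%R.
  rewrite -(ltr_int R) -(ltr_pM2l (_ : 0 < period)) ?mulr_gt0// -utk mulrN1; lra.
have k_ : k = 0 by move: k0 k1; clear; case: k => [[|n]|[|n]].
by apply/eqP; rewrite -subr_eq0 utk k_ mulr0.
Qed.

Lemma to_circle_period t : to_circle (t + period) = to_circle t.
Proof.
by apply/eqmodP/asboolP; exists 1; rewrite mulr1 addrAC subrr add0r.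
Qed.

Lemma coset_rot_period t : coset_rot (t + period) = coset_rot t.
Proof. by apply/coset_rot_eqP; exact: to_circle_period. Qed.

Lemma coset_act_rot a t : coset_act (rotation a) (coset_rot t) = coset_rot (a + t).
Proof. by rewrite /coset_act repr_coset_of /coset_rot rotationD. Qed.

Lemma coset_rot_continuous : continuous coset_rot.
Proof.
move=> t; apply: (@continuous_comp R (SO R 2) X (@rotation R) (\pi_X)%qT).
  exact: rotation_continuous.
exact: pi_continuous.
Qed.

(** Cosets being singletons, the identity of SO(2) is compatible with the quotient and descends to
    [repr]. *)
Lemma coset_repr_continuous : continuous (repr : X -> SO R 2).
Proof.
have -> : (repr : X -> SO R 2) = id \o repr by [].
apply: repr_comp_continuous => [|a b /eqP ab]; first by move=> ?.
by apply/eqP; rewrite -(repr_coset_of a) -(repr_coset_of b); congr repr.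
Qed.

Lemma coset_hausdorff : hausdorff_space X.
Proof.
move=> x y xy; rewrite -[x]reprK -[y]reprK; congr (\pi_X _)%qT.
apply: (@SO_hausdorff R 2) => U V Ux Vy.
have [z [Uz Vz]] := xy _ _ (coset_repr_continuous Ux) (coset_repr_continuous Vy).
by exists (repr z).
Qed.

Lemma coset_rot_image_compact (K : set R) : compact K -> compact (coset_rot @` K).
Proof.
apply: continuous_compact; apply: continuous_subspaceT; exact: coset_rot_continuous.
Qed.

Lemma coset_rot_image_closed (K : set R) : compact K -> closed (coset_rot @` K).
Proof.
by move=> cK; apply: compact_closed; [exact: coset_hausdorff|exact: coset_rot_image_compact].
Qed.

Lemma coset_rot_image_arc : coset_rot @` `[0, period] = [set: X].
Proof.
apply/seteqP; split => // x _; exists (coset_arg x); last exact: coset_argK.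
by rewrite /= in_itv/= coset_arg_ge0 ltW// coset_arg_lt.
Qed.

Lemma coset_compact : compact [set: X].
Proof.
by rewrite -coset_rot_image_arc; apply: coset_rot_image_compact; exact: segment_compact.
Qed.

Lemma borel_open (T : ptopologicalType) (U : set T) : open U -> measurable (U : set (borel T)).
Proof. by move=> oU; exact: sub_sigma_algebra. Qed.

Lemma borel_closed (T : ptopologicalType) (C : set T) :
  closed C -> measurable (C : set (borel T)).
Proof.
by move=> cC; rewrite -[C]setCK; apply: measurableC; apply: borel_open; exact: closed_openC.
Qed.

Lemma continuous_borel_measurable (T U : ptopologicalType) (f : T -> U) :
  continuous f -> measurable_fun [set: borel T] (f : borel T -> borel U).
Proof.
move=> /continuousP cf; apply: (@measurability _ _ _ (borel U) _ _ (@open U)) => //.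
by move=> _ [V oV <-]; rewrite setTI; apply: borel_open; exact: cf.
Qed.

Lemma continuous_borel_preimage (T U : ptopologicalType) (f : T -> U) (A : set (borel U)) :
  continuous f -> measurable A -> measurable (f @^-1` A : set (borel T)).
Proof.
move=> cf mA; rewrite -[X in measurable X]setTI.
exact: (continuous_borel_measurable cf measurableT mA).
Qed.

Lemma coset_rot_measurable : measurable_fun [set: mR] (coset_rot : mR -> borel X).
Proof.
apply: (@measurability _ _ _ (borel X) _ _ (@open X)) => //.
move=> _ [U oU <-]; rewrite setTI; apply: open_measurable.
by move/continuousP : coset_rot_continuous; exact.
Qed.

Lemma preimage_coset_rot (A : set (borel X)) : measurable A ->
  measurable (coset_rot @^-1` A : set mR).
Proof. by move=> mA; rewrite -[X in measurable X]setTI; exact: coset_rot_measurable. Qed.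

Lemma coset_arg_measurable : measurable_fun [set: borel X] (coset_arg : borel X -> mR).
Proof.
apply: (measurability _ (RGenOInfty.measurableE R)) => // _ [_ [b ->] <-]; rewrite setTI.
have [pb|bp] := leP period b.
  rewrite (_ : _ @^-1` _ = set0) => [|]; first exact: measurable0.
  apply/seteqP; split => x //=; rewrite in_itv/= andbT => bx.
  by have := lt_trans (le_lt_trans pb bx) (coset_arg_lt x); rewrite ltxx.
rewrite (_ : _ @^-1` _ = ~` (coset_rot @` `[0, b])).
  apply: measurableC; apply: borel_closed; apply: coset_rot_image_closed.
  exact: segment_compact.
apply/seteqP; split => x /=; rewrite in_itv/= andbT.
  move=> bx [t]; rewrite /= in_itv/= => /andP[t0 tb] xt; move: bx.
  by rewrite -xt coset_rotK ?t0 ?(le_lt_trans tb)// ltNge tb.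
move=> nx; rewrite ltNge; apply/negP => xb; apply: nx.
by exists (coset_arg x); rewrite ?coset_argK//= in_itv/= coset_arg_ge0.
Qed.

End CosetArc.

(** * The invariant measure on the coset space: existence, regularity and uniqueness up to a
    factor *)

Section InvariantMeasure.
Context (R : realType).
Local Open Scope ereal_scope.

Local Notation period := (2 * pi : R)%R.
Local Notation X := (coset_space (SO2_trivial R)).
Local Notation mR := (measurableTypeR R).

Definition coset_measure : set (borel X) -> \bar R :=
  pushforward (@arc_measure R) (@coset_rot R : mR -> borel X).

Let coset_measure0 : coset_measure set0 = 0.
Proof. by apply: measure0; exact: coset_rot_measurable. Qed.

Let coset_measure_ge0 A : 0 <= coset_measure A.
Proof. by rewrite /coset_measure /pushforward. Qed.

Let coset_measure_sigma_additive : semi_sigma_additive coset_measure.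
Proof.
move=> F mF tF mUF; rewrite /coset_measure.
by apply: measure_semi_sigma_additive => //; exact: coset_rot_measurable.
Qed.

HB.instance Definition _ := isMeasure.Build _ _ _ coset_measure
  coset_measure0 coset_measure_ge0 coset_measure_sigma_additive.

Lemma coset_measure_setT : coset_measure setT = period%:E.
Proof. by rewrite /coset_measure /pushforward preimage_setT arc_measure_setT. Qed.

Lemma coset_act_arg (a : R) (x : X) :
  coset_act (rotation a) x = coset_rot (a + coset_arg x).
Proof. by rewrite -coset_act_rot coset_argK. Qed.

(** Acting by a rotation translates the preimage under [coset_rot], which is a 2pi-periodic set. *)
Lemma coset_measure_invariant g (A : set (borel X)) : measurable A ->
  coset_measure (@coset_act _ (SO2_trivial R) g @^-1` A) = coset_measure A.
Proof.
move=> mA; have [rg <-] := SO2_angleP g; set a := SO2_angle g in rg *.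
rewrite /coset_measure /pushforward.
have -> : @coset_rot R @^-1` (coset_act (rotation a) @^-1` A) =
    (fun t => (a + t)%R) @^-1` (@coset_rot R @^-1` A).
  by apply/seteqP; split => t /=; rewrite coset_act_rot.
apply: arc_measure_shift => //; first exact: preimage_coset_rot.
by move=> t /=; rewrite coset_rot_period.
Qed.

(** Lebesgue measure is inner regular on the part of the preimage of [A] in [0, 2pi[, and
    [coset_rot] sends compact sets to compact sets. *)
Lemma coset_measure_inner (A : set (borel X)) (e : R) : measurable A -> (0 < e)%R ->
  exists K : set X, [/\ compact K, measurable (K : set (borel X)), K `<=` A &
    coset_measure A <= coset_measure K + e%:E].
Proof.
move=> mA e0; pose D : set mR := @coset_rot R @^-1` A `&` `[0%R, period[%classic.
have mD : measurable D by apply: measurableI => //; exact: preimage_coset_rot.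
have Dfin : lebesgue_measure D < +oo.
  apply: (@le_lt_trans _ _ (@arc_measure R setT)); last by rewrite arc_measure_setT ltry.
  rewrite /arc_measure /mrestr setTI.
  by apply: le_measure; rewrite ?inE//; exact: subIsetr.
have [V [cV VD VDe]] := lebesgue_regularity_inner mD Dfin e0.
have mV : measurable (V : set mR).
  by apply: closed_measurable; apply: compact_closed => //; exact: Rhausdorff.
have cK := coset_rot_image_compact cV.
have mK : measurable (@coset_rot R @` V : set (borel X)).
  by apply: borel_closed; exact: coset_rot_image_closed.
exists (@coset_rot R @` V); split => //.
  by move=> _ [t /VD[]] At _ <-.
change (lebesgue_measure D <= coset_measure (@coset_rot R @` V) + e%:E).
rewrite (measureDI lebesgue_measure mD mV) addeC; apply: leeD; last exact: ltW.
apply: le_measure; rewrite ?inE.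
- exact: measurableI.
- by apply: measurableI => //; exact: preimage_coset_rot.
- by move=> t [[At t0] Vt]; split => //; exists t.
Qed.

Lemma coset_measure_radon : is_radon coset_measure.
Proof.
have fin A : measurable A -> coset_measure A \is a fin_num.
  move=> mA; rewrite ge0_fin_numE ?measure_ge0//.
  rewrite (@le_lt_trans _ _ (coset_measure setT))//.
    by apply: le_measure; rewrite ?inE.
  by rewrite [coset_measure _]coset_measure_setT ltry.
have mop (U : set X) : open U -> measurable (U : set (borel X)) by exact: borel_open.
split=> [K _ mK|A mA|U oU].
- by rewrite -ge0_fin_numE ?measure_ge0// fin.
- apply/eqP; rewrite eq_le; apply/andP; split.
    apply: le_ereal_inf_tmp => _ [U [oU AU] <-].
    by apply: le_measure; rewrite ?inE//; exact: mop.
  apply/lee_addgt0Pr => e e0.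
  have mAC : measurable (~` A : set (borel X)) by exact: measurableC.
  (* Outer regularity follows by complementation: with [K] compact inside the complement of [A], the
     complement of [K] is open and contains [A], and the total mass is finite. *)
  have [K [cK mK KA leK]] := coset_measure_inner mAC e0.
  have cK' : closed K by apply: compact_closed => //; exact: coset_hausdorff.
  apply: (@le_trans _ _ (coset_measure (~` K))).
    apply: ereal_inf_lbound; exists (~` K) => //; split; first exact: closed_openC.
    by rewrite -[A]setCK; exact: subsetC.
  rewrite -(leeD2rE _ _ (fin _ mK)).
  have split_ (B : set (borel X)) : measurable B ->
      coset_measure (~` B) + coset_measure B = coset_measure setT.
    by move=> mB; rewrite (measureDI coset_measure measurableT mB) setTI setTD.
  rewrite split_// -(split_ A)// addeC -addeA leeD2lE ?fin//.
  by rewrite addeC.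
- apply/eqP; rewrite eq_le; apply/andP; split.
    apply/lee_addgt0Pr => e e0.
    have [K [cK mK KU leK]] := coset_measure_inner (mop _ oU) e0.
    apply: (le_trans leK); rewrite leeD2rE//.
    by apply: ereal_sup_ubound; exists K.
  apply: ge_ereal_sup => _ [K [cK mK KU] <-].
  by apply: le_measure; rewrite ?inE//; exact: mop.
Qed.

Lemma coset_measure_admissible : admissible coset_measure.
Proof.
split; first exact: coset_measure_radon.
- apply/eqP => nu0; have : period%:E = 0 := etrans (esym coset_measure_setT) nu0.
  by move/eqP; rewrite eqe mulf_eq0 pnatr_eq0/= gt_eqF ?pi_gt0.
- exists (fun=> 1%R); split => // g A mA.
  by rewrite invr1 mul1e; exact: coset_measure_invariant.
Qed.

(** Let E be the set of pairs (t, x) such that the rotation by t sends x into A. By invariance all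
    its sections at fixed t have measure nu A, and all those at fixed x have measure
    [coset_measure A]. Integrating in both orders gives 2pi nu A = nu(X) [coset_measure A]. *)
Lemma admissible_coset_measure (nu : {measure set (borel X) -> \bar R}) :
  admissible nu -> exists2 c : R, (0 < c)%R &
    forall A, measurable A -> nu A = c%:E * coset_measure A.
Proof.
move=> [[nuK _ _] nu0 [chi [chi0 inv]]].
have nuoo : nu setT < +oo by apply: nuK => //; exact: coset_compact.
have nufin : nu setT \is a fin_num by rewrite ge0_fin_numE.
(* The whole space is its own preimage, and its mass is finite and nonzero. *)
have chi1 g : chi g = 1%R.
  have := inv g setT measurableT; rewrite preimage_setT -(fineK nufin) -EFinM.
  move=> [] /eqP; rewrite -subr_eq0 -{1}[fine _]mul1r -mulrBl mulf_eq0.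
  rewrite fine_eq0// (negbTE nu0) orbF subr_eq0 eq_sym invr_eq1.
  by move/eqP.
have {inv}inv (g : SO R 2) (A : set (borel X)) :
    measurable A -> nu (coset_act g @^-1` A) = nu A.
  by move=> mA; rewrite inv// chi1 invr1 mul1e.
(* Restriction to the whole space equips [nu] with the finite measure structure used by Fubini's
   theorem. *)
pose m2 : {finite_measure set (borel X) -> \bar R} := mfrestr measurableT nuoo.
exists (fine (nu setT) / period)%R => [|A mA].
  by rewrite divr_gt0 ?mulr_gt0 ?pi_gt0// fine_gt0// nuoo andbT lt0e nu0 measure_ge0.
pose E : set (mR * borel X) := [set z | A (coset_rot (z.1 + coset_arg z.2))].
have mE : measurable E.
  rewrite -[E]setTI.
  have : measurable_fun [set: mR * borel X]
      (fun z : mR * borel X => coset_rot (z.1 + coset_arg z.2)%R : borel X).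
    apply: measurableT_comp; first exact: coset_rot_measurable.
    apply: measurable_funD; first exact: measurable_fst.
    by apply: measurableT_comp; [exact: coset_arg_measurable|exact: measurable_snd].
  by apply.
have := indic_fubini_tonelli (@arc_measure R) m2 mE.
rewrite indic_fubini_tonelli_FE// indic_fubini_tonelli_GE//.
have -> : m2 \o xsection E = cst (nu A).
  apply/funext => t /=; rewrite /m2/= /mfrestr /mrestr setIT -[RHS](inv (rotation t))//.
  by congr (nu _); apply/seteqP; split => x; rewrite /xsection/= inE /E/= coset_act_arg.
have -> : @arc_measure R \o ysection E = cst (coset_measure A).
  apply/funext => x /=.
  rewrite -[RHS](@arc_measure_shift _ (coset_arg x) (@coset_rot R @^-1` A)).
  - congr (arc_measure _).
    by apply/seteqP; split => t; rewrite /ysection/= inE /E/= addrC.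
  - by rewrite coset_arg_ge0 coset_arg_lt.
  - exact: preimage_coset_rot.
  - by move=> t /=; rewrite coset_rot_period.
rewrite !integral_cst//.
rewrite /m2/= /mfrestr /mrestr setIT arc_measure_setT => e.
have period0 : period != 0%R by rewrite mulf_neq0 ?pnatr_eq0// gt_eqF ?pi_gt0.
rewrite mulrC EFinM -muleA (fineK nufin) (muleC (nu setT)) -e.
by rewrite muleCA -EFinM mulVf// mule1.
Qed.

End InvariantMeasure.

(** * Homeomorphism with the circle, and triviality of the homomorphisms to R *)

Section CircleCoset.
Context (R : realType).

Local Notation period := (2 * pi : R).
Local Notation X := (coset_space (SO2_trivial R)).
Local Notation mR := (measurableTypeR R).

Definition coset_angle (x : X) : circle R := to_circle (coset_arg x).

Lemma coset_angle_rot (t : R) : coset_angle (coset_rot t) = to_circle t.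
Proof. exact: to_circle_arg. Qed.

Lemma coset_angleK : cancel coset_angle angle_coset.
Proof.
move=> x; rewrite -[RHS]coset_argK; apply/coset_rot_eqP; exact: reprK.
Qed.

Lemma angle_cosetK : cancel angle_coset coset_angle.
Proof. by move=> c; rewrite -[RHS]reprK; exact: coset_angle_rot. Qed.

Lemma angle_coset_to_circle (t : R) : angle_coset (to_circle t) = coset_rot t.
Proof. by apply/coset_rot_eqP; exact: reprK. Qed.

Lemma angle_coset_continuous : continuous (@angle_coset R).
Proof.
apply/quotient_continuous.
have -> : @angle_coset R \o (\pi_(circle R))%qT = @coset_rot R.
  by apply/funext => t; exact: angle_coset_to_circle.
exact: coset_rot_continuous.
Qed.

Lemma to_circle_continuous : continuous (@to_circle R).
Proof. exact: pi_continuous. Qed.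

Lemma circle_compact : compact [set: circle R].
Proof.
have -> : [set: circle R] = @to_circle R @` `[0, period].
  apply/seteqP; split => // c _; exists (coset_arg (angle_coset c)).
    by rewrite /= in_itv/= coset_arg_ge0 ltW// coset_arg_lt.
  exact: angle_cosetK.
apply: continuous_compact; last exact: segment_compact.
by apply: continuous_subspaceT; exact: to_circle_continuous.
Qed.

(* A continuous bijection from a compact space to a Hausdorff one is closed. *)
Lemma coset_angle_continuous : continuous coset_angle.
Proof.
apply/continuous_closedP => C cC.
have -> : coset_angle @^-1` C = @angle_coset R @` C.
  apply/seteqP; split => [x Cx|_ [c Cc <-]].
    by exists (coset_angle x) => //; exact: coset_angleK.
  by rewrite /preimage/= angle_cosetK.
apply: compact_closed; first exact: coset_hausdorff.
apply: continuous_compact.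
  by apply: continuous_subspaceT; exact: angle_coset_continuous.
apply: (subclosed_compact cC); [exact: circle_compact|by []].
Qed.

(* [tau] is bounded on the compact group SO(2), whereas [tau (g ^+ n)] is
   [n * tau g]. *)
Lemma W0_SO2 (tau : SO R 2 -> R) : W0 (SO2_trivial R) tau -> tau = cst 0.
Proof.
move=> [ctau tauD _]; apply/funext => g /=.
pose f t := tau (rotation t).
have cf : continuous f.
  move=> t; apply: (@continuous_comp R (SO R 2) R (@rotation R) tau).
    exact: rotation_continuous.
  exact: ctau.
have pi0 := @pi_ge0 R.
have [|M _ fM] := @EVT_max R f 0 period _ (continuous_subspaceT cf).
  by rewrite mulr_ge0.
have tau_le h : tau h <= f M.
  have [/andP[a0 ap] <-] := SO2_angleP h.
  by apply: fM; rewrite in_itv/= a0 ltW.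
have tauX h n : tau h *+ n <= f M.
  suff [k ->] : exists k, tau h *+ n = tau k by [].
  elim: n => [|n [k ek]].
    exists 1%g; rewrite mulr0n; apply/esym/(addrI (tau 1%g)).
    by rewrite -tauD mulg1 addr0.
  by exists (h * k)%g; rewrite mulrS ek tauD.
have tau_le0 h : tau h <= 0.
  rewrite leNgt; apply/negP => h0.
  (* This multiplier exceeds [f M / tau h], so the multiple of [tau h] exceeds the maximum [f M]. *)
  have := tauX h (Num.trunc (f M / tau h)).+1.
  rewrite leNgt -mulr_natr -ltr_pdivrMl// mulrC => /negP; apply.
  exact: truncnS_gt.
apply/eqP; rewrite eq_le tau_le0/=.
have t1 : tau 1%g = 0.
  by apply: (addrI (tau 1%g)); rewrite -tauD mulg1 addr0.
(* The same bound at the inverse gives the opposite inequality. *)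
have := tau_le0 (g^-1)%g; have : tau g + tau (g^-1)%g = 0 by rewrite -tauD mulgV.
by move/eqP; rewrite addrC addr_eq0 => /eqP ->; rewrite oppr_le0.
Qed.

End CircleCoset.

(** * Transfer of integrals to one period of the line *)

Section ArcIntegral.
Context (R : realType).
Local Open Scope ereal_scope.

Local Notation period := (2 * pi : R)%R.
Local Notation X := (coset_space (SO2_trivial R)).
Local Notation mR := (measurableTypeR R).
Local Notation arc := (@arc_measure R).

(** The complement of [D] is null for the restricted measure, and the two measures agree inside
    [D]. *)
Lemma ge0_integral_mrestr d (T : measurableType d) (mu : {measure set T -> \bar R})
    (D : set T) (mD : measurable D) (f : T -> \bar R) :
  measurable_fun setT f -> (forall x, 0 <= f x) ->
  \int[mrestr mu mD]_x f x = \int[mu]_(x in D) f x.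
Proof.
move=> mf f0.
rewrite (@ge0_negligible_integral _ _ _ (mrestr mu mD) setT (~` D))//.
- rewrite setTD setCK; apply: eq_measure_integral => A mA AD.
  by rewrite /= /mrestr setIidl.
- exact: measurableC.
- by rewrite /= /mrestr setICl measure0.
Qed.

(** The factor [c] stays explicit because it cancels later, in the normalized density. *)
Lemma admissible_integral (nu : {measure set (borel X) -> \bar R}) (c : R)
    (f : X -> \bar R) (A : set (borel X)) :
  (0 < c)%R -> (forall A, measurable A -> nu A = c%:E * coset_measure A) ->
  measurable A -> measurable_fun [set: borel X] f -> (forall x, 0 <= f x) ->
  \int[nu]_(x in A) f x =
    c%:E * \int[arc]_(t in @coset_rot R @^-1` A) f (coset_rot t).
Proof.
move=> c0 nuE mA mf f0.
rewrite (@eq_measure_integral _ _ _ _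
    (mscale (NngNum (ltW c0)) (@coset_measure R))); last first.
  by move=> B mB _; exact: nuE.
rewrite ge0_integral_mscale//=; last exact: measurable_funS mf.
congr (_ * _).
rewrite -(@ge0_integral_pushforward _ _ _ _ _ _ (@coset_rot_measurable R) arc A f)//.
exact: measurable_funS mf.
Qed.

Lemma circle_dx_integral (g : circle R -> \bar R) (B : set (borel (circle R))) :
  measurable B -> measurable_fun [set: borel (circle R)] g -> (forall x, 0 <= g x) ->
  \int[@circle_dx R]_(x in B) g x = \int[arc]_(t in @to_circle R @^-1` B) g (to_circle t).
Proof.
move=> mB mg g0.
rewrite -(@ge0_integral_pushforward _ _ mR (borel (circle R)) _ _
  (@to_circle_measurable R) arc B g)//.
exact: measurable_funS mg.
Qed.

(** Through [coset_rot] the shift becomes the action of a rotation, and [coset_measure] equals its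
    own image under that action. *)
Lemma arc_integral_shift (f : X -> \bar R) (a : R) :
  measurable_fun [set: borel X] f -> (forall x, 0 <= f x) ->
  \int[arc]_t f (coset_rot (a + t)) = \int[arc]_t f (coset_rot t).
Proof.
move=> mf f0.
have mact : measurable_fun [set: borel X]
    (@coset_act _ (SO2_trivial R) (rotation a) : borel X -> borel X).
  rewrite (_ : coset_act _ = (@coset_rot R) \o (fun x => a + coset_arg x)%R).
    apply: measurableT_comp; first exact: coset_rot_measurable.
    by apply: measurable_funD => //; exact: coset_arg_measurable.
  by apply/funext => x; rewrite coset_act_arg.
have push g : measurable_fun [set: borel X] g -> (forall x, 0 <= g x) ->
    \int[@coset_measure R]_x g x = \int[arc]_t g (coset_rot t).
  move=> mg g0; rewrite /coset_measure.
  by rewrite (ge0_integral_pushforward (@coset_rot_measurable R))// preimage_setT.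
rewrite -push// (@eq_measure_integral _ _ _ _
  (pushforward (@coset_measure R)
    (@coset_act _ (SO2_trivial R) (rotation a) : borel X -> borel X))); last first.
  by move=> A mA _ /=; rewrite /pushforward coset_measure_invariant.
rewrite (ge0_integral_pushforward mact)// preimage_setT push.
- by apply: eq_integral => t _ /=; rewrite coset_act_rot.
- exact: (measurableT_comp mf mact).
- by move=> x /=.
Qed.

End ArcIntegral.

(** * Von Mises weights, their normalization and the densities given by the method *)

Section VonMises.
Context (R : realType).
Local Open Scope ereal_scope.

Local Notation period := (2 * pi : R)%R.
Local Notation X := (coset_space (SO2_trivial R)).
Local Notation mR := (measurableTypeR R).
Local Notation arc := (@arc_measure R).

Lemma to_circle_cos (t u m : R) : to_circle t = to_circle u ->
  cos (t - m) = cos (u - m).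
Proof.
move=> /eqmodP/asboolP[k tu].
have -> : (t - m = u - m + (t - u))%R by ring.
by rewrite tu cos_add_period.
Qed.

Lemma cos_coset_arg (t : R) : cos (coset_arg (coset_rot t)) = cos t.
Proof. by have := to_circle_cos 0 (to_circle_arg t); rewrite !subr0. Qed.

Lemma measurable_comp_coset_arg (f : R -> R) : continuous f ->
  measurable_fun [set: borel X] (fun x : borel X => (f (coset_arg x))%:E).
Proof.
move=> cf; apply/measurable_EFinP.
apply: (@measurableT_comp _ _ _ (borel X) mR mR f); last exact: coset_arg_measurable.
exact: continuous_measurable_fun.
Qed.

Lemma continuous_weight (k m : R) : continuous (fun t : R => expR (- k * cos (t - m))).
Proof.
move=> t; apply: (@continuous_comp _ _ _ (fun t => - k * cos (t - m))%R (@expR R)).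
  apply: cvgMr; apply: (@continuous_comp _ _ _ (fun t => t - m)%R (@cos R)).
    by apply: cvgB; [exact: cvg_id|exact: cvg_cst].
  exact: continuous_cos.
exact: continuous_expR.
Qed.

(** Translation by pi - m turns [- cos (t - m)] into [cos t]; this absorbs both the centre and the
    minus sign of the weight. *)
Lemma arc_integral_weight (k m : R) :
  \int[arc]_t (expR (- k * cos (t - m)))%:E = (period * besselI 0 k)%:E.
Proof.
pose h (x : borel X) := (expR (k * cos (coset_arg x)))%:E.
have ck : continuous (fun t : R => expR (k * cos t)).
  move=> t; have := @continuous_weight (- k) 0 t; rewrite opprK.
  by under [X in continuous_at _ X -> _]funext do rewrite subr0.
have mh : measurable_fun [set: borel X] h.
  exact: (measurable_comp_coset_arg ck).
have h0 x : 0 <= h x by rewrite lee_fin expR_ge0.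
transitivity (\int[arc]_t h (coset_rot ((pi - m) + t))).
  apply: eq_integral => t _; rewrite /h cos_coset_arg.
  have -> : (pi - m + t = t - m + pi)%R by ring.
  by rewrite cosDpi mulrN mulNr.
rewrite (arc_integral_shift _ mh h0).
under eq_integral do rewrite /h cos_coset_arg.
rewrite ge0_integral_mrestr//; last first.
  by apply/measurable_EFinP; exact: continuous_measurable_fun.
(* [besselI] integrates over the closed interval; the endpoint 2pi is negligible. *)
rewrite integral_itv_bndo_bndc; last first.
  apply/measurable_EFinP; apply: measurable_funS (continuous_measurable_fun ck) => //.
(* Finiteness ensures that the [fine] inside the real-valued integral returns the true value and not
   its default 0. *)
have : lebesgue_measure.-integrable `[0%R, period] (EFin \o (fun t => expR (k * cos t))).
  apply: continuous_compact_integrable; first exact: segment_compact.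
  exact: continuous_subspaceT.
move=> /integrable_fin_num fint.
rewrite /besselI mulrA divff ?mul1r; last first.
  by rewrite mulf_neq0 ?pnatr_eq0// gt_eqF ?pi_gt0.
under eq_Rintegral do rewrite mul0r cos0 mul1r.
by rewrite /Rintegral fineK// fint.
Qed.

(** The weight is at least exp(-|k|) everywhere, on an arc of mass 2pi. *)
Lemma von_mises_mass_gt0 (k : R) : (0 < period * besselI 0 k)%R.
Proof.
have pi0 := @pi_gt0 R; have period0 : (0 < period)%R by rewrite mulr_gt0.
rewrite -lte_fin -(arc_integral_weight k 0).
apply: (@lt_le_trans _ _ (\int[arc]_t (expR (- `|k|))%:E)).
  rewrite integral_cst// [X in _ * X]arc_measure_setT.
  by rewrite -EFinM lte_fin mulr_gt0// expR_gt0.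
apply: ge0_le_integral => //.
  by apply/measurable_EFinP; apply: continuous_measurable_fun; exact: continuous_weight.
move=> t _; rewrite lee_fin ler_expR.
rewrite -[(- k * _)%R]opprK lerN2 (le_trans (ler_norm _))// mulNr opprK normrM.
by rewrite ler_piMr// cos_max.
Qed.

Lemma continuous_real_measurable (T : ptopologicalType) (f : T -> R) :
  continuous f -> measurable_fun [set: borel T] (f : borel T -> R).
Proof.
move=> /continuousP cf.
apply: (measurability _ (RGenOInfty.measurableE R)) => // _ [_ [b ->] <-].
by rewrite setTI; apply: borel_open; apply: cf; apply: interval_open.
Qed.

Lemma circle_cos_sub_to_circle (t : R) (mu : circle R) :
  circle_cos_sub (to_circle t) mu = cos (t - repr mu).
Proof. by apply: to_circle_cos; exact: reprK. Qed.

Lemma circle_cos_sub_continuous (mu : circle R) :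
  continuous (fun x : circle R => circle_cos_sub x mu).
Proof.
apply/quotient_continuous.
have -> : (fun x : circle R => circle_cos_sub x mu) \o (\pi_(circle R))%qT =
    (fun t => cos (t - repr mu)%R).
  by apply/funext => t; exact: circle_cos_sub_to_circle.
move=> t; apply: (@continuous_comp _ _ _ (fun t => t - repr mu)%R (@cos R)).
  by apply: cvgB; [exact: cvg_id|exact: cvg_cst].
exact: continuous_cos.
Qed.

Lemma measurable_von_mises_density (k : R) (mu : circle R) :
  measurable_fun [set: borel (circle R)]
    (fun x : borel (circle R) => (von_mises_density k mu x)%:E).
Proof.
apply/measurable_EFinP/measurable_funM => //.
apply: (measurableT_comp (@measurable_expR R)); apply: measurable_funM => //.
exact: (continuous_real_measurable (@circle_cos_sub_continuous mu)).
Qed.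

Lemma von_mises_density_ge0 (k : R) (mu x : circle R) : (0 <= von_mises_density k mu x)%R.
Proof.
by rewrite mulr_ge0 ?expR_ge0// invr_ge0 ltW// von_mises_mass_gt0.
Qed.

Lemma von_mises_integral (k : R) (mu : circle R) (B : set (borel (circle R))) :
  measurable B ->
  \int[@circle_dx R]_(x in B) (von_mises_density k mu x)%:E =
  ((period * besselI 0 k)^-1)%:E *
    \int[arc]_(t in @to_circle R @^-1` B) (expR (- k * cos (t - repr mu)))%:E.
Proof.
move=> mB; rewrite circle_dx_integral//; last 2 first.
- exact: measurable_von_mises_density.
- by move=> x; rewrite lee_fin von_mises_density_ge0.
rewrite -ge0_integralZl.
- apply: eq_integral => t _.
  by rewrite /von_mises_density circle_cos_sub_to_circle EFinM.
- by rewrite -[X in measurable X]setTI; exact: to_circle_measurable.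
- apply/measurable_EFinP; apply: (@measurable_funS _ _ _ _ setT) => //.
  by apply: continuous_measurable_fun; exact: continuous_weight.
- by move=> t _; rewrite lee_fin expR_ge0.
- by rewrite lee_fin invr_ge0 ltW// von_mises_mass_gt0.
Qed.

(** * Parameters with zero homomorphism and linear form in polar coordinates *)

Section Density.
Context (theta : param R (SO R 2) 2) (k m : R).
Hypothesis theta2 : theta.2 = cst 0%R.
Hypothesis theta1 : theta.1 (e1 R) = (k * cos m)%R.
Hypothesis theta1' : theta.1 (delta_mx 1 0)%R = (k * sin m)%R.

(** The rotation by t sends [e1] to (cos t, sin t), so linearity and the subtraction formula leave a
    single cosine. *)
Lemma ptilde_density_weight (x : X) :
  ptilde_density (natural_rep R 2) (e1 R) theta x =
  expR (- k * cos (coset_arg x - m)).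
Proof.
rewrite -{1}[x]coset_argK /ptilde_density repr_coset_of theta2 addr0 mulNr.
congr (expR (- _)); set t := coset_arg x.
have -> : natural_rep R 2 (rotation t) *m e1 R =
    (cos t *: e1 R + sin t *: delta_mx 1 0)%R.
  apply/matrixP => i j; rewrite !mxE !big_ord_recl big_ord0 !mxE.
  rewrite (ord1 j).
  by case: i => [[|[|//]] ?] /=; rewrite ?mulr0 ?mulr1 ?addr0 ?add0r.
rewrite linearD !linearZ /= theta1 theta1' cosB; ring.
Qed.

Lemma ptilde_weight (nu : {measure set (borel X) -> \bar R}) (c : R) A :
  (0 < c)%R -> (forall A, measurable A -> nu A = c%:E * coset_measure A) ->
  measurable A ->
  ptilde (natural_rep R 2) (e1 R) nu theta A =
  c%:E * \int[arc]_(t in @coset_rot R @^-1` A) (expR (- k * cos (t - m)))%:E.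
Proof.
move=> c0 nuE mA; rewrite /ptilde.
under eq_integral do rewrite ptilde_density_weight.
rewrite (admissible_integral c0 nuE mA (measurable_comp_coset_arg (@continuous_weight k m))).
  congr (_ * _); apply: eq_integral => t _.
  by rewrite (to_circle_cos _ (to_circle_arg t)).
by move=> x; rewrite lee_fin expR_ge0.
Qed.

Lemma ptilde_setT_weight (nu : {measure set (borel X) -> \bar R}) (c : R) :
  (0 < c)%R -> (forall A, measurable A -> nu A = c%:E * coset_measure A) ->
  ptilde (natural_rep R 2) (e1 R) nu theta setT = (c * (period * besselI 0 k))%:E.
Proof.
move=> c0 nuE; rewrite (ptilde_weight c0 nuE measurableT) preimage_setT.
by rewrite arc_integral_weight.
Qed.

(** The factor relating [nu] to [coset_measure] occurs in the integral and in the total mass, and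
    cancels. *)
Lemma p_von_mises (nu : {measure set (borel X) -> \bar R}) (B : set (borel (circle R))) :
  admissible nu -> measurable B ->
  p_ (natural_rep R 2) (e1 R) nu theta (@coset_angle R @^-1` B) =
  \int[@circle_dx R]_(x in B) (von_mises_density k (to_circle m) x)%:E.
Proof.
move=> /admissible_coset_measure[c c0 nuE] mB.
have mB' : measurable (@coset_angle R @^-1` B : set (borel X)).
  exact: (continuous_borel_preimage (@coset_angle_continuous R)).
rewrite /p_ (ptilde_setT_weight c0 nuE) (ptilde_weight c0 nuE mB') von_mises_integral//.
rewrite muleA -EFinM /=; congr (_%:E * _).
  by rewrite invfM mulrAC mulVf ?gt_eqF ?mul1r.
have -> : @coset_rot R @^-1` (@coset_angle R @^-1` B) = @to_circle R @^-1` B.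
  by apply/seteqP; split => t /=; rewrite coset_angle_rot.
apply: eq_integral => t _; congr (expR (_ * _))%:E.
(* [to_circle_cos] changes the first term of a difference; by evenness of cosine it also replaces
   [m] by the chosen representative of its class. *)
rewrite -[LHS]cosN -[RHS]cosN !opprB; apply: to_circle_cos.
by apply/esym; exact: reprK.
Qed.

Lemma Theta_weight (nu : {measure set (borel X) -> \bar R}) :
  admissible nu -> Theta (natural_rep R 2) (e1 R) nu theta.
Proof.
move=> /admissible_coset_measure[c c0 nuE]; split.
  by rewrite theta2; split => [|g h|//]; [exact: cst_continuous|rewrite addr0].
by rewrite (ptilde_setT_weight c0 nuE) ltry.
Qed.

End Density.

End VonMises.

(** * The uniform distribution is not a von Mises distribution *)

Section Disjointness.
Context (R : realType).
Local Open Scope ereal_scope.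

Local Notation period := (2 * pi : R)%R.
Local Notation X := (coset_space (SO2_trivial R)).
Local Notation mR := (measurableTypeR R).
Local Notation arc := (@arc_measure R).

(** The two sets correspond to subsets of the coset space that differ by a rotation. *)
Lemma arc_measure_cos_shift (m : R) (D : set mR) : measurable D ->
  arc [set t | D (cos (t - m)%R)] = arc [set t | D (cos t)].
Proof.
move=> mD; pose S : set (borel X) := [set x | D (cos (coset_arg x))].
have mS : measurable S.
  rewrite -[S]setTI.
  have : measurable_fun [set: borel X] (fun x : borel X => cos (coset_arg x) : mR).
    apply: (@measurableT_comp _ _ _ (borel X) mR mR); last exact: coset_arg_measurable.
    exact: continuous_measurable_fun (@continuous_cos R).
  by apply.
have -> : [set t | D (cos t)] = @coset_rot R @^-1` S.
  by apply/seteqP; split => t /=; rewrite /S/= cos_coset_arg.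
have -> : [set t | D (cos (t - m)%R)] =
    @coset_rot R @^-1` (coset_act (rotation (- m)) @^-1` S).
  by apply/seteqP; split => t /=; rewrite /S/= coset_act_rot cos_coset_arg addrC.
exact: coset_measure_invariant.
Qed.

(** A mass that is finite and positive can be cancelled when two densities are compared on [A]. *)
Lemma arc_measure_fin_gt0 (A : set mR) (a b : R) : measurable A ->
  (0 <= a < b)%R -> (b < period)%R -> `[a, b] `<=` A ->
  exists2 r : R, (0 < r)%R & arc A = r%:E.
Proof.
move=> mA /andP[a0 ab] bp abA.
have fA : arc A \is a fin_num by exact: fin_num_measure.
exists (fine (arc A)); last by rewrite fineK.
rewrite -lte_fin fineK//; apply: (@lt_le_trans _ _ (b - a)%:E).
  by rewrite lte_fin subr_gt0.
have -> : (b - a)%:E = lebesgue_measure (`[a, b]%classic : set mR).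
  by rewrite lebesgue_measure_itv/= lte_fin ab EFinB.
rewrite /arc_measure /mrestr; apply: le_measure; rewrite ?inE//.
  exact: measurableI.
move=> t /= tab; split; first exact: abA.
move: tab; rewrite !in_itv/= => /andP[at_ tb].
by rewrite (le_trans a0)//= (le_lt_trans tb).
Qed.

(* If q were both von Mises and uniform, comparing the two densities on an arc
   where the cosine is at least cos 1 and on one where it is at most 0 would
   give 1/(2 pi) <= exp (- kappa cos 1) / (2 pi I_0) and
   1/(2 pi I_0) <= 1/(2 pi). *)
Lemma von_mises_uniform_disjoint : von_mises_family R `&` uniform_family R = set0.
Proof.
apply/seteqP; split => // q [[k [mu [k0 qk]]] qu].
have pi0 := @pi_gt0 R; have pi2 := @pi_ge2 R; have Z0 := von_mises_mass_gt0 k.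
set Z := (period * besselI 0 k)%R in Z0.
pose w t := expR (- k * cos (t - repr mu)).
(* The value of q on the points whose cosine relative to mu lies in [D] is computed from both
   descriptions of q; by rotation invariance only the mass for the unshifted cosine has to be
   known. *)
have key (D : set mR) : measurable D ->
    (exists2 r : R, (0 < r)%R & arc [set t | D (cos t)] = r%:E) ->
    exists2 r : R, (0 < r)%R & arc [set t | D (cos (t - repr mu)%R)] = r%:E /\
      (Z^-1)%:E * \int[arc]_(t in [set t | D (cos (t - repr mu)%R)]) (w t)%:E =
      ((period)^-1 * r)%:E.
  move=> mD [r r0 arcr]; exists r => //.
  have e : arc [set t | D (cos (t - repr mu)%R)] = r%:E by rewrite arc_measure_cos_shift.
  split => //.
  pose B : set (borel (circle R)) := [set x | D (circle_cos_sub x mu)].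
  have mB : measurable B.
    have mcos := continuous_real_measurable (@circle_cos_sub_continuous R mu).
    by have := mcos measurableT _ mD; rewrite setTI.
  have BE : @to_circle R @^-1` B = [set t | D (cos (t - repr mu)%R)].
    by apply/seteqP; split => t /=; rewrite /B/= circle_cos_sub_to_circle.
  have := qk _ mB; rewrite qu// von_mises_integral// BE => <-.
  rewrite EFinM; congr (_ * _).
  change (arc (@to_circle R @^-1` B) = r%:E); by rewrite BE.
have mw A : measurable_fun A (EFin \o w).
  apply/measurable_EFinP; apply: (@measurable_funS _ _ _ _ setT) => //.
  by apply: continuous_measurable_fun; exact: continuous_weight.
have mcos (D : set mR) : measurable D -> measurable [set t : mR | D (cos (t - repr mu)%R)].
  move=> mD; rewrite -[X in measurable X]setTI.
  have : measurable_fun [set: mR] (fun t : mR => cos (t - repr mu)%R : mR).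
    apply: continuous_measurable_fun => t.
    apply: (@continuous_comp _ _ _ (fun t => t - repr mu)%R (@cos R)).
      by apply: cvgB; [exact: cvg_id|exact: cvg_cst].
    exact: continuous_cos.
  by apply.
have mcos0 (D : set mR) : measurable D -> measurable [set t : mR | D (cos t)].
  move=> mD; rewrite -[X in measurable X]setTI.
  exact: (continuous_measurable_fun (@continuous_cos R)).
have lo : (period^-1 <= Z^-1 * expR (- k * cos 1))%R.
  pose D : set mR := `[cos 1, +oo[%classic.
  have mD : measurable D by exact: measurable_itv.
  have [|r r0 [arcr e]] := key D mD.
    apply: (@arc_measure_fin_gt0 _ 0 1); [exact: mcos0|by rewrite lexx ltr01|lra|].
    move=> t /=; rewrite /D/= !in_itv/= andbT => /andP[t0 t1].
    rewrite leNgt; apply/negP; rewrite ltr_cos ?in_itv/=.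
    + by rewrite ltNge t1.
    + by apply/andP; split; lra.
    + by apply/andP; split; lra.
  rewrite -(ler_pM2r r0) -lee_fin -e -mulrA EFinM.
  apply: lee_wpmul2l; first by rewrite lee_fin invr_ge0 ltW.
  rewrite EFinM -arcr -integral_cst; last exact: mcos.
  apply: ge0_le_integral => //.
  - exact: mcos.
  - by move=> t _; rewrite lee_fin expR_ge0.
  - exact: mw.
  move=> t; rewrite /D/= in_itv/= andbT => ct.
  by rewrite lee_fin /w ler_expR !mulNr lerN2 ler_pM2l.
have hi : (Z^-1 <= period^-1)%R.
  pose D : set mR := `]-oo, 0%R]%classic.
  have mD : measurable D by exact: measurable_itv.
  have [|r r0 [arcr e]] := key D mD.
    apply: (@arc_measure_fin_gt0 _ (pi / 2) pi); [exact: mcos0|by apply/andP; split; lra|lra|].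
    move=> t /=; rewrite /D/= !in_itv/= => /andP[t0 t1].
    rewrite leNgt -(@cos_pihalf R); apply/negP; rewrite ltr_cos ?in_itv/=.
    + by rewrite ltNge t0.
    + by apply/andP; split; lra.
    + by apply/andP; split; lra.
  rewrite -(ler_pM2r r0) -lee_fin -e EFinM.
  apply: lee_wpmul2l; first by rewrite lee_fin invr_ge0 ltW.
  rewrite -[r%:E]mul1e -arcr -integral_cst; last exact: mcos.
  apply: ge0_le_integral => //; [exact: mcos|exact: mw|].
  move=> t; rewrite /D/= in_itv/= => ct.
  by rewrite lee_fin /w -expR0 ler_expR mulNr oppr_ge0 pmulr_rle0.
(* Together the bounds give 1 <= exp(-k cos 1), although k and cos 1 are positive. *)
have := le_trans hi lo; rewrite -ler_pdivrMl ?invr_gt0// mulVf ?invr_eq0 ?gt_eqF//.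
by rewrite leNgt -{2}(@expR0 R) ltr_expR mulNr oppr_lt0 mulr_gt0// cos1_gt0.
Qed.

End Disjointness.

(** * The family obtained by the method, carried to the circle *)

Section MethodFamily.
Context (R : realType).
Local Open Scope ereal_scope.

Local Notation X := (coset_space (SO2_trivial R)).

(** Realizes any pair of values on the standard basis, as needed to return from (k, mu) to a
    parameter. *)
Definition plane_form (a b : R) (v : 'cV[R]_2) : R := (a * v 0 0 + b * v 1 0)%R.

Let plane_form_linear a b : linear_for *%R (plane_form a b).
Proof. by move=> r u v; rewrite /plane_form !mxE; ring. Qed.

HB.instance Definition _ a b :=
  GRing.isLinear.Build R 'cV[R]_2 R *%R (plane_form a b) (plane_form_linear a b).

(** The weight is constant for k = 0, so [arc_integral_weight] yields I_0(0) = 1. *)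
Lemma von_mises_integral0 (mu : circle R) (B : set (borel (circle R))) :
  measurable B ->
  \int[@circle_dx R]_(x in B) (von_mises_density 0 mu x)%:E =
  ((2 * pi)^-1)%:E * circle_dx B.
Proof.
move=> mB; have mass : ((2 * pi * besselI 0 0)%:E = (2 * pi)%:E :> \bar R).
  rewrite -(arc_integral_weight 0 0) -arc_measure_setT -[RHS]mul1e.
  rewrite -integral_cst//; apply: eq_integral => t _.
  by rewrite oppr0 mul0r expR0.
case: mass => mass; rewrite -[RHS]integral_cst//; apply: eq_integral => x _.
by rewrite /von_mises_density mass oppr0 mul0r expR0 mulr1.
Qed.

(** Allowing k = 0 treats the von Mises and uniform distributions together. One direction puts the
    linear form in polar coordinates, the other builds a form from k and mu. *)
Lemma transport_method_family (nu : {measure set (borel X) -> \bar R})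
    (q : probability (borel (circle R)) R) :
  admissible nu ->
  transport (@coset_angle R) (method_family (natural_rep R 2) (e1 R) nu) q <->
  exists (k : R) (mu : circle R), (0 <= k)%R /\
    forall B : set (borel (circle R)), measurable B ->
      q B = \int[@circle_dx R]_(x in B) (von_mises_density k mu x)%:E.
Proof.
move=> adm; split.
  intros [p [theta [W0theta _] ptheta] qp].
  have [k k0 [m [ak bk]]] :=
    polar_coordinates (theta.1 (e1 R)) (theta.1 (delta_mx 1 0)%R).
  exists k, (to_circle m); split => // B mB.
  rewrite -(p_von_mises (W0_SO2 W0theta) ak bk adm mB) qp//; apply: ptheta.
  exact: (continuous_borel_preimage (@coset_angle_continuous R)).
intros [k [mu [k0 qk]]]; pose m := repr mu.
pose phi : {scalar 'cV[R]_2} := plane_form (k * cos m) (k * sin m).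
pose theta : param R (SO R 2) 2 := (phi, cst 0%R).
have th2 : theta.2 = cst 0%R by [].
have th1 : theta.1 (e1 R) = (k * cos m)%R.
  by rewrite /theta/= /plane_form !mxE/= mulr1 mulr0 addr0.
have th1' : theta.1 (delta_mx 1 0)%R = (k * sin m)%R.
  by rewrite /theta/= /plane_form !mxE/= mulr1 mulr0 add0r.
have mf := continuous_borel_measurable (@angle_coset_continuous R).
(* The required measure on the coset space is the image of [q] under [angle_coset]; the packing
   makes this image a probability. *)
pose f : {mfun borel (circle R) >-> borel X} :=
  HB.pack (@angle_coset R) (isMeasurableFun.Build _ _ _ _ _ mf).
exists (distribution q f) => [|B mB].
  exists theta; first exact: (Theta_weight th2 th1 th1' adm).
  intros A mA; change (q (@angle_coset R @^-1` A) = p_ (natural_rep R 2) (e1 R) nu theta A).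
  have mA' : measurable (@angle_coset R @^-1` A : set (borel (circle R))).
    exact: (continuous_borel_preimage (@angle_coset_continuous R)).
  apply: (etrans (qk _ mA')).
  (* [p_von_mises] concerns preimages under [coset_angle], and every Borel set is one. *)
  have {2}-> : A = @coset_angle R @^-1` (@angle_coset R @^-1` A).
    by apply/seteqP; split => x /=; rewrite coset_angleK.
  rewrite (p_von_mises th2 th1 th1' adm mA').
  by rewrite /to_circle /m reprK.
rewrite /distribution /pushforward/=; congr (q _).
by apply/seteqP; split => x /=; rewrite angle_cosetK.
Qed.

End MethodFamily.

(** The zero linear form is an allowed parameter and gives the uniform distribution, hence the
    union; the last clause says that this member is not already of von Mises type with positive
    kappa. *)
Theorem proposition4p12 (R : realType) :
  fixed_vector (SO2_trivial R) (natural_rep R 2) (e1 R) /\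
  (exists nu : {measure set (borel (coset_space (SO2_trivial R))) -> \bar R},
     admissible nu) /\
  (exists coset_angle : coset_space (SO2_trivial R) -> circle R,
    inverse_homeomorphisms coset_angle angle_coset /\
    (forall x : R,
       coset_angle (coset_of (SO2_trivial R) (rotation x)) = to_circle x) /\
    forall nu : {measure set (borel (coset_space (SO2_trivial R))) -> \bar R},
      admissible nu ->
      transport coset_angle (method_family (natural_rep R 2) (e1 R) nu)
        = von_mises_family R `|` uniform_family R) /\
  von_mises_family R `&` uniform_family R = set0.
Proof.
split; first by move=> h; rewrite inE => /eqP ->; rewrite /= mul1mx.
split; first by exists (@coset_measure R); exact: coset_measure_admissible.
split; last exact: von_mises_uniform_disjoint.
exists (@coset_angle R); split.
  split; [exact: coset_angleK|exact: angle_cosetK| |].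
    exact: coset_angle_continuous.
  exact: angle_coset_continuous.
split; first exact: coset_angle_rot.
move=> nu adm; apply/seteqP; split => q.
  intros [k [mu [k0 qk]]]%(transport_method_family _ adm).
  have [k_0|k_neq0] := eqVneq k 0.
    by right => B mB; rewrite qk// k_0 von_mises_integral0.
  by left; exists k, mu; rewrite lt_def k_neq0.
intros [[k [mu [k0 qk]]]|qu]; apply (transport_method_family _ adm).
  by exists k, mu; rewrite ltW.
(* For k = 0 the density does not depend on the centre, so any mu would do. *)
by exists 0, (to_circle 0); split => // B mB; rewrite von_mises_integral0// qu.
Qed.
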